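(* Let $K\ge1$ be an integer and let $\epsilon>0$ with $\epsilon<K$. There exists an instance of the covering-type two-stage stochastic problem with $K$ scenarios and $z^I>0$ such that the optimal objective value $z^*$ obtained after adding all weak specific-scenario cuts satisfies $$z^*\le\frac{1}{K-\epsilon}\cdot z^I .$$
   Context: A covering-type two-stage stochastic problem with $K$ scenarios is a mixed integer linear program of the form: minimize $c^Ty+\sum_{i=1}^K(d^i)^Tz^i$ subject to constraints involving only first-stage variables, $Ay\ge b$, and, for each $i=1,\dots,K$, constraints $A^iy+B^iz^i\ge b^i$; here $y$ are the first-stage variables, $z^i$ the second-stage variables of scenario $i$, all variables are nonnegative, a specified subset of variables is required to be integer, and all matrices, right-hand sides and objective vectors have nonnegative rational entries. Let $P$ be the feasible region, $P^I$ its convex hull, $P^{LP}$ the feasible region of the linear programming relaxation, and $z^I$ the minimum of the objective over $P^I$. Weak specific-scenario cuts: the rows of the constraint system are partitioned into $K$ blocks $I_1,\dots,I_K$, where block $I_i$ contains the rows $A^iy+B^iz^i\ge b^i$ of scenario $i$ (and each row involving only first-stage variables is placed in one of the blocks). Let $N_i$ be the set of variables that have a nonzero coefficient in at least one row of $I_i$. A weak specific-scenario cut is a linear inequality valid for $P^I$ whose coefficients vanish outside $N_i$ for some $i\in\{1,\dots,K\}$. $z^*$ is the minimum of the objective over the points of $P^{LP}$ that satisfy all weak specific-scenario cuts. *)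

(* Defs.v *)
From HB Require Import structures.
From mathcomp Require Import all_boot all_order all_algebra.
From mathcomp Require Import all_classical all_reals convex.

Set Implicit Arguments.
Unset Strict Implicit.
Unset Printing Implicit Defensive.

Import Order.TTheory GRing.Theory Num.Theory.

Local Open Scope classical_set_scope.
Local Open Scope ring_scope.

(* inl j is the first-stage variable y_j; inr (Tagged _ l) with tag i is the
   second-stage variable z^i_l. *)
Definition variable (K n : nat) (p : 'I_K -> nat) : finType :=
  ('I_n + {i : 'I_K & 'I_(p i)})%type.

(* The data of the problem
     minimize    c y + \sum_i d^i z^i
     subject to  A y >= b,  A^i y + B^i z^i >= b^i for all i,
                 y, z^i >= 0,  v integer for every variable v in integral,
   together with the scenario block in which each row of A y >= b is placed. *)
Record instance (K : nat) := Instance {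
  n_first : nat;
  n_second : 'I_K -> nat;
  m_first : nat;
  m_second : 'I_K -> nat;
  cost : 'rV[rat]_n_first;
  scost : forall i, 'rV[rat]_(n_second i);
  matA : 'M[rat]_(m_first, n_first);
  rhs : 'cV[rat]_m_first;
  smatA : forall i, 'M[rat]_(m_second i, n_first);
  smatB : forall i, 'M[rat]_(m_second i, n_second i);
  srhs : forall i, 'cV[rat]_(m_second i);
  integral : {set variable n_first n_second};
  placement : 'I_m_first -> 'I_K;
  cost_ge0 : cost \is a mxOver Num.nneg;
  scost_ge0 : forall i, scost i \is a mxOver Num.nneg;
  matA_ge0 : matA \is a mxOver Num.nneg;
  rhs_ge0 : rhs \is a mxOver Num.nneg;
  smatA_ge0 : forall i, smatA i \is a mxOver Num.nneg;
  smatB_ge0 : forall i, smatB i \is a mxOver Num.nneg;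
  srhs_ge0 : forall i, srhs i \is a mxOver Num.nneg
}.

Arguments placement {K} _ _.

Section TwoStage.
Context (R : realType) (K : nat) (J : instance K).

Definition var : finType := variable (n_first J) (@n_second _ J).

Definition vec := {ffun var -> R}.

Definition first_stage (x : vec) : 'cV[R]_(n_first J) := \col_j x (inl j).

Definition second_stage (x : vec) (i : 'I_K) : 'cV[R]_(n_second J i) :=
  \col_l x (inr (Tagged (fun i => 'I_(n_second J i)) l)).

Definition objective (x : vec) : R :=
  (map_mx ratr (cost J) *m first_stage x
   + \sum_i map_mx ratr (scost J i) *m second_stage x i) 0 0.

(* P^LP *)
Definition lp_region : set vec := [set x : vec |
  [/\ forall v, 0 <= x v,
      forall r, ratr (rhs J r 0) <= (map_mx ratr (matA J) *m first_stage x) r 0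
    & forall i r, ratr (srhs J i r 0) <=
        (map_mx ratr (smatA J i) *m first_stage x
         + map_mx ratr (smatB J i) *m second_stage x i) r 0]].

(* P *)
Definition feasible_region : set vec :=
  lp_region `&` [set x : vec | forall v, v \in integral J -> x v \is a Num.int].

(* P^I *)
Definition integer_hull : set vec :=
  smallest (@convex_set R {ffun var -> R^o}) feasible_region.

(* N_i; a second-stage variable of scenario k can only occur in block k. *)
Definition block_vars (i : 'I_K) : {set var} := [set v : var | match v with
  | inl j => [exists r, smatA J i r j != 0]
             || [exists r, (placement J r == i) && (matA J r j != 0)]
  | inr l => (tag l == i) && [exists r, smatB J (tag l) r (tagged l) != 0]
  end]%SET.

(* (a, beta) stands for the inequality \sum_v a v * x v >= beta. *)
Definition satisfies (a : {ffun var -> R}) (beta : R) (x : vec) : Prop :=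
  beta <= \sum_v a v * x v.

Definition weak_specific_scenario_cut (a : {ffun var -> R}) (beta : R) : Prop :=
  (forall x, integer_hull x -> satisfies a beta x) /\
  exists i : 'I_K, forall v, v \notin block_vars i -> a v = 0.

Definition weak_closure : set vec := lp_region `&`
  [set x : vec | forall a beta,
     weak_specific_scenario_cut a beta -> satisfies a beta x].

Definition is_minimum (S : set vec) (z : R) : Prop :=
  (objective @` S) z /\ lbound (objective @` S) z.

End TwoStage.

Arguments lp_region R {K} J _.
Arguments feasible_region R {K} J _.
Arguments integer_hull R {K} J _.
Arguments weak_closure R {K} J _.

(* Main.v *)
(* Index the first-stage variables, all of cost 1, by the points of the grid
   [q]^K, and let scenario i ask that every set T meeting all the slabs
   {p | p i = a} satisfy \sum_(p in T) y_p + z^i >= 1, where z^i costs q^K. An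
   integer solution with z = 0 contains a slab in each of the K directions, so
   the integer optimum is q^K - (q-1)^K, close to K q^(K-1). A cut attached to
   scenario i does not see z^k for k <> i, so it may assume z^k = 1; then one
   slab in direction i is enough, and averaging over these q slabs shows that the
   uniform point y = 1/q, z = 0, of cost q^(K-1), satisfies all the cuts. Summing
   the rows of the q^K diagonals shows that no point of the linear relaxation
   costs less. *)

Require Import Defs.
From mathcomp Require Import all_boot all_order all_algebra.
From mathcomp Require Import all_classical all_reals.
From mathcomp Require Import interval_inference convex.
From mathcomp Require Import ring lra.

Import Order.TTheory GRing.Theory Num.Theory.
Local Open Scope ring_scope.

(** * Transversals, diagonals and slabs of the grid *)

Section Grid.
Variables (K Q : nat).

Definition grid := {ffun 'I_K -> 'I_Q.+1}.

Definition transversal (i : 'I_K) (T : {set grid}) : bool :=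
  [forall a, [exists p in T, p i == a]].

Lemma transversal_card (i : 'I_K) (T : {set grid}) :
  transversal i T -> (Q.+1 <= #|T|)%N.
Proof.
move=> /forallP trT.
apply: leq_trans (leq_imset_card (fun p : grid => p i) T).
rewrite -{1}(card_ord Q.+1) -cardsT; apply/subset_leq_card/fintype.subsetP => a _.
have /existsP [p /andP [pT /eqP <-]] := trT a.
exact: imset_f.
Qed.

(** Addition in ['I_Q.+1] is cyclic, so a diagonal takes each value exactly once in every
    coordinate. *)
Definition translate (u : grid) (c : 'I_Q.+1) : grid := [ffun k => u k + c].

Definition diagonal (u : grid) : {set grid} :=
  [set translate u c | c : 'I_Q.+1]%SET.

Lemma diagonal_transversal i u : transversal i (diagonal u).
Proof.
apply/forallP => a; apply/existsP; exists (translate u (a - u i)).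
by rewrite imset_f //= ffunE addrC subrK.
Qed.

Lemma translate_inj u (i : 'I_K) : injective (translate u).
Proof. by move=> c d /ffunP /(_ i); rewrite !ffunE => /addrI. Qed.

Lemma translate_bij c : bijective (translate^~ c).
Proof.
by exists (translate^~ (- c)) => u; apply/ffunP => k; rewrite !ffunE ?addrK ?subrK.
Qed.

(** For each fixed shift [c], [translate^~ c] permutes the grid and contributes one full sum of [y].
    The index [i] witnesses a coordinate, without which the shifts of [u] would coincide. *)
Lemma sum_diagonal (R : realType) (y : grid -> R) (i : 'I_K) :
  \sum_u \sum_(p in diagonal u) y p = Q.+1%:R * \sum_p y p.
Proof.
rewrite (eq_bigr (fun u => \sum_c y (translate u c))) => [|u _]; last first.
  by apply: big_imset => c d _ _ /(@translate_inj u i).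
rewrite exchange_big /= (eq_bigr (fun=> \sum_p y p)).
  by rewrite sumr_const card_ord mulr_natl.
move=> c _; rewrite [RHS](reindex (translate^~ c)) //=.
exact/onW_bij/translate_bij.
Qed.

Definition slabs (h : grid) : {set grid} := [set p : grid | [exists i, p i == h i]]%SET.

(** The complement of [slabs h] is a product of [K] sets of size [Q]: the points avoiding [h i] in
    every coordinate [i]. *)
Lemma card_slabs h : (#|slabs h| + Q ^ K = Q.+1 ^ K)%N.
Proof.
have -> : (Q.+1 ^ K = #|{: grid}|)%N by rewrite card_ffun !card_ord.
rewrite -(cardsC (slabs h)); congr addn.
transitivity #|(family (fun i => predC1 (h i)) : simpl_pred grid)|.
  rewrite card_family -[X in (Q ^ X)%N](size_enum_ord K) /image_mem.
  by elim: (enum _) => //= i s <-; rewrite expnS cardC1 card_ord.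
apply: eq_card => p; rewrite !inE negb_exists.
by apply/forallP/forallP => hp i; have := hp i.
Qed.

(* Each scenario has one row per set T of points; its right-hand side is 0, which
   makes the row void, unless T is a transversal. *)
Program Definition grid_instance (i0 : 'I_K) : instance K := {|
  n_first := #|{: grid}|;
  n_second := fun=> 1%N;
  m_first := 0;
  m_second := fun=> #|{: {set grid}}|;
  cost := const_mx 1;
  scost := fun=> const_mx (Q.+1 ^ K)%:R;
  matA := 0;
  rhs := 0;
  smatA := fun=> \matrix_(r, j) ((enum_val j : grid) \in (enum_val r : {set grid}))%:R;
  smatB := fun=> const_mx 1;
  srhs := fun i => \col_r (transversal i (enum_val r : {set grid}))%:R;
  integral := [set: _]%SET;
  placement := fun=> i0
|}.
Solve All Obligations with
  by move=> *; apply/mxOverP => *; rewrite !mxE nnegrE.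

(** * The instance in the coordinates y and z *)

Section Region.
Context (R : realType) (i0 : 'I_K).
Local Notation J := (grid_instance i0).
Local Notation vecJ := (vec R J).

Definition grid_vec (y : grid -> R) (z : 'I_K -> R) : vecJ :=
  [ffun v => match v with inl j => y (enum_val j) | inr l => z (tag l) end].

Definition ycoord (x : vecJ) (p : grid) : R := x (inl (enum_rank p)).

Definition zvar (i : 'I_K) : var J :=
  inr (@Tagged _ i (fun i => 'I_(n_second J i)) (ord0 : 'I_1)).

Definition zcoord (x : vecJ) (i : 'I_K) : R := x (zvar i).

Lemma grid_vecK x : grid_vec (ycoord x) (zcoord x) = x.
Proof.
apply/ffunP => -[j|[i l]]; rewrite ffunE /ycoord ?enum_valK //.
by rewrite /zcoord /= [l]ord1.
Qed.

Lemma grid_objective y z :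
  objective (grid_vec y z) = \sum_p y p + (Q.+1 ^ K)%:R * \sum_i z i.
Proof.
rewrite /objective !mxE; congr (_ + _).
  rewrite [RHS]big_enum_val; apply: eq_bigr => j _.
  by rewrite !mxE ffunE rmorph1 mul1r.
rewrite summxE mulr_sumr; apply: eq_bigr => i _.
by rewrite !mxE big_ord1 !mxE ffunE ratr_nat.
Qed.

Lemma grid_lp_region y z :
  lp_region R J (grid_vec y z) <->
  [/\ forall p, 0 <= y p, forall i, 0 <= z i
    & forall i T, transversal i T -> 1 <= \sum_(p in T) y p + z i].
Proof.
have row i r : (map_mx ratr (smatA J i) *m first_stage (grid_vec y z)
    + map_mx ratr (smatB J i) *m second_stage (grid_vec y z) i) r 0
    = \sum_(p in enum_val r) y p + z i.
  rewrite !mxE big_ord1 !mxE ffunE rmorph1 mul1r; congr (_ + _).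
  rewrite [RHS]big_mkcond [RHS]big_enum_val; apply: eq_bigr => j _ /=.
  by rewrite !mxE ffunE ratr_nat mulr_natl mulrb.
split=> [[x0 _ rows]|[y0 z0 rows]].
  split=> [p|i|i T trT].
  - by have := x0 (inl (enum_rank p)); rewrite ffunE enum_rankK.
  - by have := x0 (zvar i);
      rewrite ffunE.
  - by have := rows i (enum_rank T); rewrite row mxE enum_rankK trT ratr_nat.
split=> [[j|l]|[]//|i r]; rewrite ?ffunE //.
rewrite row mxE ratr_nat; case: (boolP (transversal _ _)) => [|_].
  exact: rows.
by rewrite addr_ge0 // sumr_ge0.
Qed.

Lemma grid_feasible_region y z :
  feasible_region R J (grid_vec y z) <->
  [/\ lp_region R J (grid_vec y z), forall p, y p \is a Num.int
    & forall i, z i \is a Num.int].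
Proof.
split=> [[lpx intx]|[lpx inty intz]]; split=> //.
- by move=> p; have := intx (inl (enum_rank p)); rewrite inE ffunE enum_rankK; exact.
- move=> i.
  have := intx (zvar i).
  by rewrite inE ffunE; exact.
- by move=> [j|l] _; rewrite ffunE.
Qed.

(** * Integer solutions and the integer optimum *)

(** The rows of the other scenarios are met by their own z; in scenario [i], every transversal meets
    the slab at level [a]. *)
Lemma slab_feasible (i : 'I_K) (a : 'I_Q.+1) :
  feasible_region R J (grid_vec (fun p => (p i == a)%:R) (fun k => (k != i)%:R)).
Proof.
apply/grid_feasible_region; split=> //.
apply/grid_lp_region; split=> // k T.
have [->|_] /= := eqVneq k i; last by rewrite lerDr sumr_ge0.
move=> /forallP /(_ a) /existsP [p /andP [pT pa]].
by rewrite (bigD1 p) //= pa addr0 lerDl sumr_ge0.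
Qed.

Lemma slabs_feasible h :
  feasible_region R J (grid_vec (fun p => (p \in slabs h)%:R) (fun=> 0)).
Proof.
apply/grid_feasible_region; split=> //.
apply/grid_lp_region; split=> // k T.
move=> /forallP /(_ (h k)) /existsP [p /andP [pT pa]].
have ph : p \in slabs h by rewrite inE; apply/existsP; exists k.
by rewrite (bigD1 p) //= ph addr0 lerDl sumr_ge0.
Qed.

Lemma int_ge1 (t : R) : t \is a Num.int -> 0 < t -> 1 <= t.
Proof. by move=> /intrP [m ->]; rewrite ltr0z ler1z. Qed.

Lemma feasible_objective_ge (x : vecJ) :
  feasible_region R J x -> (Q.+1 ^ K)%:R - (Q ^ K)%:R <= objective x.
Proof.
rewrite -(grid_vecK x); move: (ycoord x) (zcoord x) => y z.
rewrite grid_objective => /grid_feasible_region [/grid_lp_region [y0 z0 rows] yi zi].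
(* A nonzero [z i] is at least 1 by integrality, and its cost alone reaches the bound. *)
have [z_eq0|] := boolP [forall i, z i == 0]; last first.
  rewrite negb_forall => /existsP [i zi_neq0].
  have zi1 : 1 <= \sum_i z i.
    rewrite (bigD1 i) //= (le_trans (y := z i)) ?lerDl ?sumr_ge0 //.
    by rewrite int_ge1 // lt_neqAle eq_sym zi_neq0 z0.
  have : (Q.+1 ^ K)%:R * 1 <= (Q.+1 ^ K)%:R * \sum_i z i :> R by rewrite ler_wpM2l.
  have : 0 <= \sum_p y p by rewrite sumr_ge0.
  have : 0 <= (Q ^ K)%:R :> R by [].
  lra.
rewrite [\sum_i z i]big1 ?mulr0 ?addr0; last by move=> i _; apply/eqP/(forallP z_eq0).
(* The row of the zero set of [y] fails, so this set misses a slab in each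
   direction. *)
have full i : exists a, [forall p : grid, (p i == a) ==> (0 < y p)].
  apply/existsP; rewrite -[[exists _, _]]negbK negb_exists; apply/negP => /forallP noslab.
  have /rows : transversal i [set p | y p == 0]%SET.
    apply/forallP => a; have := noslab a; rewrite negb_forall => /existsP [p].
    rewrite negb_imply => /andP [pa yp]; apply/existsP; exists p.
    by rewrite inE pa andbT; move: yp; rewrite lt_neqAle y0 andbT negbK eq_sym.
  rewrite (eqP (forallP z_eq0 i)) addr0 big1 ?ler10 // => p.
  by rewrite inE => /eqP.
have /fin_all_exists [h hP] := full.
(* By integrality [y] is at least 1 on all the slabs found, so its sum is at least their
   cardinality. *)
rewrite -(card_slabs (finfun h)) natrD addrK -sum1_card natr_sum big_mkcond /=.
apply: ler_sum => p _; case: ifP => // ; rewrite inE => /existsP [i].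
by rewrite ffunE => pi; rewrite int_ge1 //; exact: (implyP (forallP (hP i) p)).
Qed.

Lemma objective_conv (x x' w : vecJ) (t t' : R) :
  (forall v, w v = t * x v + t' * x' v) ->
  objective w = t * objective x + t' * objective x'.
Proof.
move=> wE.
rewrite -(grid_vecK w) -(grid_vecK x) -(grid_vecK x') !grid_objective.
rewrite /ycoord /zcoord.
under eq_bigr do rewrite wE.
under [X in _ + _ * X = _]eq_bigr do rewrite wE.
rewrite !big_split /= -!mulr_sumr; ring.
Qed.

(** A half-space given by the objective is convex, so it contains the hull once it contains the
    feasible points. *)
Lemma hull_objective_ge (x : vecJ) :
  integer_hull R J x -> (Q.+1 ^ K)%:R - (Q ^ K)%:R <= objective x.
Proof.
set V := (X in X <= _) => hx.
suff : (smallest (@convex_set R {ffun var J -> R^o}) (feasible_region R J)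
   `<=` [set x : vecJ | V <= objective x])%classic by apply.
apply: smallest_sub => [|w]; last exact: feasible_objective_ge.
move=> u w t; rewrite !inE => uV wV /=.
rewrite (@objective_conv u w _ t%:num (1 - t%:num)); last first.
  by move=> v; rewrite /conv /= !ffunE.
have := ge0 t; have := le1 t => t1 t0.
rewrite /= in uV wV *.
have : t%:num * V <= t%:num * objective u by rewrite ler_wpM2l.
have : (1 - t%:num) * V <= (1 - t%:num) * objective w.
  by rewrite ler_wpM2l // subr_ge0.
lra.
Qed.

Lemma hull_minimum : is_minimum (integer_hull R J) ((Q.+1 ^ K)%:R - (Q ^ K)%:R).
Proof.
split; last by move=> _ [x hx <-]; exact: hull_objective_ge.
exists (grid_vec (fun p => (p \in slabs [ffun=> ord0])%:R) (fun=> 0)).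
  by apply: sub_gen_smallest; exact: slabs_feasible.
rewrite grid_objective [X in _ * X]big1 // mulr0 addr0.
rewrite -(card_slabs [ffun=> ord0]) natrD addrK -sum1_card natr_sum.
by rewrite [RHS]big_mkcond /=; apply: eq_bigr => p _; case: (_ \in _).
Qed.

(** * The optimum under the weak cuts *)

(** The diagonal rows of the single scenario [i0] suffice: each point lies on [Q.+1] diagonals, and
    the resulting z term is dominated by the cost of [z i0]. *)
Lemma lp_objective_ge (x : vecJ) :
  lp_region R J x -> (Q.+1 ^ K)%:R / Q.+1%:R <= objective x.
Proof.
rewrite -(grid_vecK x); move: (ycoord x) (zcoord x) => y z.
rewrite grid_objective => /grid_lp_region [y0 z0 rows].
have q1 : 1 <= Q.+1%:R :> R by rewrite ler1n.
have zi0 : z i0 <= \sum_i z i by rewrite (bigD1 i0) //= lerDl sumr_ge0.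
have : \sum_(u : grid) 1 <= \sum_u (\sum_(p in diagonal u) y p + z i0).
  by apply: ler_sum => u _; apply: rows; exact: diagonal_transversal.
rewrite big_split /= sum_diagonal // !sumr_const card_ffun !card_ord.
rewrite -[z i0 *+ _]mulr_natl => le_sum.
rewrite ler_pdivrMr ?(lt_le_trans ltr01) // (le_trans le_sum) //.
rewrite mulrDl [_ * Q.+1%:R]mulrC lerD2l -mulrA ler_wpM2l //.
rewrite (le_trans zi0) // ler_peMr // sumr_ge0 //.
Qed.

Lemma uniform_weak_closure :
  weak_closure R J (grid_vec (fun=> Q.+1%:R^-1) (fun=> 0)).
Proof.
have q0 : 0 < Q.+1%:R :> R by [].
split.
  (* A transversal has at least [Q.+1] points, each of weight [1 / Q.+1]. *)
  apply/grid_lp_region; split=> // i T /transversal_card cT.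
  by rewrite addr0 sumr_const -[_ *+ #|T|]mulr_natl ler_pdivlMr // mul1r ler_nat.
move=> a beta [valid [i supp]].
(* On the variables of block [i], the point is the average of the [slab_feasible i c]. *)
have slab_valid (c : 'I_Q.+1) := valid _ (sub_gen_smallest (slab_feasible i c)).
have : \sum_(c < Q.+1) beta <= \sum_(c < Q.+1) \sum_v a v *
    grid_vec (fun p => (p i == c)%:R) (fun k => (k != i)%:R) v.
  by apply: ler_sum => c _; exact: slab_valid.
rewrite exchange_big /= sumr_const card_ord -[beta *+ _]mulr_natl -ler_pdivlMl //.
rewrite /satisfies mulr_sumr => /le_trans; apply.
rewrite le_eqVlt; apply/orP; left; apply/eqP; apply: eq_bigr => -[j|l] _.
  rewrite -mulr_sumr mulrCA ffunE; congr (_ * _).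
  under eq_bigr => c _ do rewrite ffunE.
  rewrite (bigD1 (enum_val j i)) //= eqxx big1 ?addr0 ?mulr1 // => c cj.
  by rewrite eq_sym (negbTE cj).
(* The averaged points have [z i = 0], as the uniform point does; on the other z, where they differ
   from it, the cut has coefficient 0. *)
have [li|nli] := eqVneq (tag l) i.
  rewrite big1 ?mulr0 => [|c _]; rewrite ffunE ?mulr0 //.
  by rewrite /= li eqxx mulr0.
have -> : a (inr l) = 0 by apply: supp; rewrite inE (negbTE nli).
by rewrite big1 ?mulr0 ?mul0r // => c _; rewrite mul0r.
Qed.

Lemma closure_minimum :
  is_minimum (weak_closure R J) ((Q.+1 ^ K)%:R / Q.+1%:R).
Proof.
split; last by move=> _ [x [lpx _] <-]; exact: lp_objective_ge.
exists (grid_vec (fun=> Q.+1%:R^-1) (fun=> 0)); first exact: uniform_weak_closure.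
rewrite grid_objective [X in _ * X]big1 // mulr0 addr0 sumr_const.
by rewrite card_ffun !card_ord -[_ *+ (_ ^ _)]mulr_natl.
Qed.

End Region.
End Grid.

(** * Comparison of the two optima *)

(** With [q = Q.+1], this is [1 - (1 - 1/q)^K >= K/q - K^2/q^2] cleared of denominators. *)
Lemma slabs_ratio (R : realType) (K Q : nat) :
  Q.+1%:R ^+ K * (K%:R * Q.+1%:R - K%:R ^+ 2)
  <= Q.+1%:R ^+ 2 * (Q.+1%:R ^+ K - Q%:R ^+ K) :> R.
Proof.
set q : R := Q.+1%:R.
have -> : Q%:R = q - 1 by rewrite /q -natr1 addrK.
have q0 : 0 <= q - 1 by rewrite /q -natr1 addrK.
elim: K => [|k IHk]; first by rewrite !expr0 mul0r expr2 mul0r !subrr !mulr0.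
have k0 : 0 <= k%:R :> R by [].
have P0 : 0 <= q ^+ k by rewrite exprn_ge0 //; lra.
have := ler_wpM2l q0 IHk.
(* This is exactly the slack between the goal and the induction hypothesis multiplied by [q - 1]. *)
have : 0 <= q ^+ k * ((k%:R + 1) * q + k%:R ^+ 2).
  by rewrite mulr_ge0 // addr_ge0 ?mulr_ge0 ?sqr_ge0; lra.
rewrite !exprS -natr1; move: (q ^+ k) ((q - 1) ^+ k) => A B.
lra.
Qed.

Theorem theorem24 (R : realType) (K : nat) (eps : R) :
  (1 <= K)%N -> 0 < eps -> eps < K%:R ->
  exists (J : instance K) (zI zstar : R),
    [/\ is_minimum (integer_hull R J) zI, 0 < zI,
        is_minimum (weak_closure R J) zstar
      & zstar <= 1 / (K%:R - eps) * zI].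
Proof.
move=> K1 eps0 epsK.
(* Chosen so that [K q - K^2 >= (K - eps) q] for [q = Q.+1], which absorbs the error term of
   [slabs_ratio]. *)
pose Q := Num.truncn (K%:R ^+ 2 / eps).
have Qlarge : K%:R ^+ 2 <= eps * Q.+1%:R.
  by rewrite mulrC -ler_pdivrMr // ltW // truncnS_gt.
exists (grid_instance K Q (Ordinal K1)), ((Q.+1 ^ K)%:R - (Q ^ K)%:R),
  ((Q.+1 ^ K)%:R / Q.+1%:R).
split; [exact: hull_minimum| |exact: closure_minimum|].
  by rewrite subr_gt0 ltr_nat ltn_exp2r.
have := slabs_ratio R K Q; rewrite !natrX.
move: Qlarge (ltr0Sn R Q) (exprn_ge0 K (ler0n R Q.+1)).
move: (Q.+1%:R : R) (Q%:R : R) => q q'.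
move: (q ^+ K) (q' ^+ K) => A B Qlarge q0 A0 ratio.
rewrite mul1r [leRHS]mulrC ler_pdivlMr ?subr_gt0 //.
(* The factor [q ^+ 2] brings the right-hand side to the form in [slabs_ratio]. *)
rewrite -(ler_pM2r (x := q ^+ 2)) ?exprn_gt0 //.
have : 0 <= A * (eps * q - K%:R ^+ 2) by rewrite mulr_ge0 // subr_ge0.
have -> : A / q * (K%:R - eps) * q ^+ 2 = A * (K%:R - eps) * q.
  by field; rewrite gt_eqF.
move: ratio; lra.
Qed.
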